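(* Let $\beta>0$ and consider the generalized semi Mittag-Leffler law SML$(a,b,\beta)$, i.e. the non-degenerate probability law on $[0,\infty)$ with Laplace transform $\phi(s)=[1+\psi(s)]^{-\beta}$, where $\psi$ is continuous on $[0,\infty)$, $\psi(0)=0$, $\psi(s)=a\psi(bs)$ for all $s\ge 0$, $0<b<1<a$ and $ab^{\alpha}=1$ with $\alpha\in(0,1]$. Let $N$ be a positive-integer-valued random variable. Then the law is $N$-sum stable, with scale parameter denoted $c$, if and only if $N$ has the Harris$(a,k)$ law, $\beta=1/k$ and $c=b$, where $k$ is a positive integer, the numbers $a$ and $k$ being the same in SML$(a,b,1/k)$ and in Harris$(a,k)$.
   Context: For $a>1$ and an integer $k>0$, the Harris$(a,k)$ law is the law on the positive integers with probability generating function $t/\{a-(a-1)t^k\}^{1/k}$. A probability law on $[0,\infty)$ with Laplace transform $\phi$ is $N$-sum stable if $P(\phi(cs))=\phi(s)$ for all $s>0$ and some $c\in(0,1)$, where $P$ is the probability generating function of $N$; this $c$ is called the scale parameter.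
   Formalization: With a, b fixed the claim fails for c≠b (exponential law, a=2, b=1/2, N Harris(4,1), c=1/4). Proved instead: stability with scale c iff the law is SML(a',c,1/k), N is Harris(a',k) and β=1/k for some a', k; and for c=b, iff N is Harris(a,k) and β=1/k for some k. *)

(* Defs.v *)
From HB Require Import structures.
From mathcomp Require Import all_boot all_order all_algebra.
From mathcomp Require Import all_classical all_reals all_analysis.

Set Implicit Arguments.
Unset Strict Implicit.
Unset Printing Implicit Defensive.

Import Order.TTheory GRing.Theory Num.Theory.
Import numFieldNormedType.Exports.

Local Open Scope classical_set_scope.
Local Open Scope ring_scope.

Section definitions.
Context {R : realType}.

Definition law_on_nonneg (mu : probability (measurableTypeR R) R) : Prop :=
  mu `[0%R, +oo[%classic = 1%E.

Definition nondegenerate (mu : probability (measurableTypeR R) R) : Prop :=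
  forall x : R, mu [set x] != 1%E.

Definition laplace (mu : probability (measurableTypeR R) R) (s : R) : R :=
  \int[mu]_(x in `[0, +oo[) expR (- (s * x)).

Definition pgf {d} {T : measurableType d} (P : probability T R)
  (N : {mfun T >-> nat}) (t : R) : R :=
  fine 'E_P[(fun w => t ^+ N w)].

Definition harris {d} {T : measurableType d} (P : probability T R)
  (N : {mfun T >-> nat}) (a : R) (k : nat) : Prop :=
  [/\ 1 < a, (0 < k)%N &
      forall t : R, 0 <= t <= 1 ->
        pgf P N t = t / ((a - (a - 1) * t ^+ k) `^ k%:R^-1)].

Definition sum_stable {d} {T : measurableType d} (P : probability T R)
  (N : {mfun T >-> nat}) (c : R)
  (mu : probability (measurableTypeR R) R) : Prop :=
  [/\ law_on_nonneg mu, 0 < c < 1 &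
      forall s : R, 0 < s -> pgf P N (laplace mu (c * s)) = laplace mu s].

(* Since [powR] is total, the condition [0 < 1 + psi s], under which
   [1 + psi s]^(- beta) is a genuine real power, is stated explicitly. *)
Definition SML (a b beta : R)
  (mu : probability (measurableTypeR R) R) : Prop :=
  [/\ law_on_nonneg mu, nondegenerate mu, 0 < beta, 0 < b < 1 & 1 < a] /\
  (exists2 alpha : R, 0 < alpha <= 1 & a * b `^ alpha = 1) /\
  exists psi : R -> R,
    [/\ {within `[0, +oo[, continuous psi},
        psi 0 = 0,
        forall s, 0 <= s -> psi s = a * psi (b * s),
        forall s, 0 <= s -> 0 < 1 + psi s &
        forall s, 0 <= s -> laplace mu s = (1 + psi s) `^ (- beta)].

End definitions.

(* Main.v *)
(* Write Q for the generating function of N and t = (1 + psi(cs))^(-beta), so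
   that stability reads Q((1 + psi(cs))^(-beta)) = (1 + psi s)^(-beta).
   Replacing s by s b^(-n) multiplies both psi(cs) and psi s by a^n and sends t
   to 0; since Q(t)/t tends to p_1 = P(N = 1), this gives
   psi s = a' psi(cs) with a' = p_1^(-1/beta).  Comparing psi with s^alpha
   yields a' c^alpha = 1, hence a' > 1.  As psi takes all positive values,
   Q(t) = t (a' - (a' - 1) t^(1/beta))^(-beta) on (0, 1), so that
   Q(t) - p_1 t has order t^(1 + 1/beta) at 0.  It is also a power series,
   of integral order, so 1/beta is an integer k and Q is the generating
   function of Harris(a', k). *)
Require Import Defs.
From HB Require Import structures.
From mathcomp Require Import all_boot all_order all_algebra.
From mathcomp Require Import all_classical all_reals all_analysis.
From mathcomp Require Import measurable_realfun ring.

Import Order.TTheory GRing.Theory Num.Theory.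
Import numFieldNormedType.Exports.

Local Open Scope classical_set_scope.
Local Open Scope ring_scope.

(** * Generating functions bounded by their partial sums *)

Section generating_function.
Context {R : realType} {d} {T : measurableType d} (P : probability T R).
Variable N : {mfun T >-> nat}.

Definition pmass (n : nat) : R := fine (P (N @^-1` [set n])).

Lemma measurable_level n : measurable (N @^-1` [set n]).
Proof. by rewrite -[_ @^-1` _]setTI; exact: measurable_funP. Qed.

Lemma pmass_ge0 n : 0 <= pmass n.
Proof. by rewrite fine_ge0. Qed.

Lemma pmass_0 : (forall w, (0 < N w)%N) -> pmass 0 = 0.
Proof.
move=> N0; rewrite /pmass (_ : _ @^-1` _ = set0) ?measure0//.
by rewrite -subset0 => w /= Nw; have := N0 w; rewrite Nw.
Qed.

Lemma integral_level_sum (m : nat) (t : R) : 0 <= t ->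
  (\int[P]_w (\sum_(n < m) t ^+ n * \1_(N @^-1` [set val n]) w)%:E =
   (\sum_(n < m) pmass n * t ^+ n)%:E)%E.
Proof.
move=> t0; under eq_integral do rewrite -sumEFin.
rewrite ge0_integral_sum//=; last 2 first.
- move=> n; apply/measurable_EFinP/measurable_funM => //.
  exact: measurable_indic (measurable_level n).
- by move=> n w _; rewrite lee_fin mulr_ge0 ?exprn_ge0.
rewrite -sumEFin; apply: eq_bigr => n _.
under eq_integral do rewrite EFinM.
rewrite ge0_integralZl//; last 2 first.
- by apply/measurable_EFinP/measurable_indic/measurable_level.
- by rewrite lee_fin exprn_ge0.
rewrite integral_indic ?setIT//; last exact: measurable_level.
rewrite EFinM muleC; congr (_ * _)%E; rewrite /pmass fineK; first by [].
by apply: fin_num_measure; exact: measurable_level.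
Qed.

Lemma measurable_expN (t : R) : measurable_fun setT (fun w => t ^+ N w).
Proof. by apply: (measurableT_comp (f := fun n : nat => t ^+ n)). Qed.

(** Truncating [t ^+ N] to the event [N < m] loses at most [t ^+ m], as [t <= 1]. These two bounds
    are all that the later comparison of orders at 0 uses of the power series. *)
Lemma pgf_partial_sum (m : nat) (t : R) : 0 <= t <= 1 ->
  \sum_(n < m) pmass n * t ^+ n <= pgf P N t <=
  \sum_(n < m) pmass n * t ^+ n + t ^+ m.
Proof.
move=> /andP[t0 t1].
pose S w : R := \sum_(n < m) t ^+ n * \1_(N @^-1` [set val n]) w.
have S0 w : 0 <= S w by apply: sumr_ge0 => n _; rewrite mulr_ge0 ?exprn_ge0.
have mS : measurable_fun setT S.
  apply: measurable_sum => n; apply: measurable_funM => //.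
  exact: measurable_indic (measurable_level n).
have SE w : S w = if (N w < m)%N then t ^+ N w else 0.
  case: ifPn => [Nm|]; rewrite /S.
    rewrite (bigD1 (Ordinal Nm))//= indicE mem_set// mulr1 big1 ?addr0//.
    move=> n nN; rewrite indicE memNset ?mulr0//= => Nn.
    by move: nN; rewrite -val_eqE /= Nn eqxx.
  rewrite -leqNgt => mN; rewrite big1// => n _.
  rewrite indicE memNset ?mulr0//= => Nn.
  by move: mN; rewrite Nn leqNgt ltn_ord.
have SN w : S w <= t ^+ N w by rewrite SE; case: ifP => // _; rewrite exprn_ge0.
have NS w : t ^+ N w <= S w + t ^+ m.
  rewrite SE; case: ifPn => [_|]; first by rewrite lerDl exprn_ge0.
  by rewrite -leqNgt add0r => mNw; rewrite ler_wiXn2l.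
have mN := measurable_expN t.
have iS := integral_level_sum m t t0.
have le1 : ((\sum_(n < m) pmass n * t ^+ n)%:E <=
    'E_P[fun w => (t ^+ N w)%R])%E.
  rewrite -iS expectation.unlock; apply: ge0_le_integral => //= [|||w _].
  - by move=> w _; rewrite lee_fin; exact: S0.
  - exact/measurable_EFinP.
  - exact/measurable_EFinP.
  - by rewrite lee_fin; exact: SN.
have le2 : ('E_P[fun w => (t ^+ N w)%R] <=
    (\sum_(n < m) pmass n * t ^+ n + t ^+ m)%:E)%E.
  rewrite EFinD -iS expectation.unlock.
  have -> : ((t ^+ m)%:E = \int[P]_w (t ^+ m)%:E)%E.
    by rewrite integral_cst//= probability_setT mule1.
  rewrite -ge0_integralD//=; last 3 first.
  - by move=> w _; rewrite lee_fin; exact: S0.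
  - exact/measurable_EFinP.
  - by move=> w _; rewrite lee_fin exprn_ge0.
  apply: ge0_le_integral => //= [|||w _].
  - by move=> w _; rewrite lee_fin exprn_ge0.
  - exact/measurable_EFinP.
  - by apply: emeasurable_funD => //; exact/measurable_EFinP.
  - by rewrite -EFinD lee_fin; exact: NS.
rewrite /pgf -!lee_fin fineK ?le1//.
by rewrite fin_real// (lt_le_trans (ltNyr _) le1) (le_lt_trans le2 (ltry _)).
Qed.

Lemma pgf_1 : pgf P N 1 = 1.
Proof.
rewrite /pgf (_ : (fun _ => _) = cst 1) ?expectation_cst//.
by apply/funext => w; rewrite expr1n.
Qed.

Lemma pgf_0 : (forall w, (0 < N w)%N) -> pgf P N 0 = 0.
Proof.
move=> N0; rewrite /pgf (_ : (fun _ => _) = cst 0) ?expectation_cst//.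
by apply/funext => w; rewrite expr0n gtn_eqF.
Qed.

End generating_function.

(** * Laplace transforms: monotonicity and nondegeneracy *)

Section laplace_transform.
Context {R : realType} (mu : probability (measurableTypeR R) R).

Lemma integrable_laplace_kernel (s : R) : 0 <= s ->
  mu.-integrable `[0, +oo[ (EFin \o (fun x : R => expR (- (s * x)))).
Proof.
move=> s0; apply: measurable_bounded_integrable => //.
- by rewrite (le_lt_trans (probability_le1 _ _))// ltry.
- apply: measurable_funTS; apply: measurableT_comp => //.
  by apply: measurableT_comp => //; apply: measurable_funM.
- exists 1; split=> // M M1 x /=; rewrite in_itv/= andbT => x0.
  rewrite ger0_norm ?expR_ge0// (le_trans _ (ltW M1))//.
  by rewrite -expR0 ler_expR oppr_le0 mulr_ge0.
Qed.

Lemma laplace_nonincreasing (s t : R) :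
  0 <= s -> s <= t -> laplace mu t <= laplace mu s.
Proof.
move=> s0 st; apply: le_Rintegral => //.
- exact/integrable_laplace_kernel/(le_trans s0).
- exact: integrable_laplace_kernel.
- move=> x /=; rewrite in_itv/= andbT => x0.
  by rewrite ler_expR lerN2 ler_wpM2r.
Qed.

(** Otherwise the nonnegative function [1 - expR (- x)] has integral 0 over the half-line, hence
    vanishes almost everywhere. Its only zero is 0, so [mu] would be the point mass at 0. *)
Lemma laplace_1_neq1 : law_on_nonneg mu -> Defs.nondegenerate mu ->
  laplace mu 1 <> 1.
Proof.
move=> mu1 nondeg L1; move/eqP: (nondeg 0); apply.
pose D : set (measurableTypeR R) := `[0, +oo[%classic.
have mD : measurable D by exact: measurable_itv.
have i1 := integrable_laplace_kernel 1 ler01.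
pose f (x : measurableTypeR R) := (1 - expR (- (1 * x)))%:E.
have i0 : mu.-integrable `[0, +oo[ (EFin \o cst (1 : R)).
  apply: measurable_bounded_integrable => //.
    by rewrite (le_lt_trans (probability_le1 _ _))// ltry.
  by exists 1; split=> // M M1 x _ /=; rewrite normr1 ltW.
have f0 x : `[0, +oo[%classic x -> (0 <= f x)%E.
  rewrite /= in_itv/= andbT => x0.
  by rewrite lee_fin subr_ge0 mul1r -expR0 ler_expR oppr_le0.
have If0 : (\int[mu]_(x in `[0%R, +oo[) f x = 0)%E.
  rewrite /f integralB_EFin// integral_cst//=.
  rewrite -[X in (_ - X)%E]fineK; last exact: integrable_fin_num.
  by rewrite [fine _]L1 [X in (_ * X)%E]mu1 mule1 -EFinB subrr.
have mf : measurable_fun D f.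
  apply/measurable_EFinP; apply: measurable_funB => //.
  by case/integrableP: i1 => /measurable_EFinP.
have : ae_eq mu D f (cst 0%E).
  apply/ae_eq_integral_abs => //; rewrite -[RHS]If0; apply: eq_integral => x.
  by rewrite inE => /f0; exact: gee0_abs.
move=> [A [mA A0 fA]].
have sub : D `<=` [set 0] `|` A.
  move=> x Dx; have [->|x0] := eqVneq x 0; [by left|right].
  apply: fA => /=; apply/not_implyP; split=> // -[] /eqP.
  rewrite subr_eq0 mul1r eq_sym => /eqP; rewrite -expR0 => /expR_inj /eqP.
  by rewrite oppr_eq0 (negbTE x0).
pose Z : set (measurableTypeR R) := [set 0].
have mZ : measurable Z by exact: measurable_set1.
apply/eqP; rewrite eq_le probability_le1//= -mu1.
have -> : mu [set 0] = (mu Z + mu A)%E by rewrite A0 adde0.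
apply: le_trans (measureU2 _ _ _) => //.
by apply: le_measure; rewrite ?inE//; exact: measurableU.
Qed.

End laplace_transform.

(** * Real powers and comparison of exponents near 0 *)

Section real_powers.
Context {R : realType}.
Implicit Types x y r s : R.

Lemma ler_powRN r x y : 0 < r -> 0 < x -> 0 < y ->
  (x `^ (- r) <= y `^ (- r)) = (y <= x).
Proof.
move=> r0 x0 y0.
by rewrite /powR !gt_eqF// ler_expR !mulNr lerN2 ler_pM2l// ler_ln.
Qed.

Lemma powRN_inj r x y : 0 < r -> 0 < x -> 0 < y ->
  x `^ (- r) = y `^ (- r) -> x = y.
Proof.
by move=> r0 x0 y0 /eqP; rewrite eq_le !ler_powRN// -eq_le => /eqP.
Qed.

Lemma powRNV r x : 0 < r -> 0 < x -> (x `^ (- r)) `^ (- r^-1) = x.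
Proof.
by move=> r0 x0; rewrite -powRrM mulrNN mulfV ?gt_eqF// powRr1// ltW.
Qed.

Lemma powRVN r x : 0 < r -> 0 < x -> (x `^ (- r^-1)) `^ (- r) = x.
Proof. by move=> r0 x0; rewrite -{2}(invrK r) powRNV// invr_gt0. Qed.

Lemma exists_exprn_lt x y : 0 <= x < 1 -> 0 < y -> exists n, x ^+ n < y.
Proof.
move=> /andP[x0 x1] y0; have Nx : `|x| < 1 by rewrite ger0_norm.
have /cvgrPdist_lt/(_ y y0)[n _ /(_ n (leqnn n))] := cvg_expr Nx.
by rewrite sub0r normrN ger0_norm ?exprn_ge0//; exists n.
Qed.

Lemma exists_exprn_gt x y : 1 < x -> exists n, y < x ^+ n.
Proof.
move=> x1; have x0 : 0 < x := lt_trans ltr01 x1.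
have y0 : 0 < `|y| + 1 by rewrite ltr_wpDl.
have [||n] := @exists_exprn_lt x^-1 (`|y| + 1)^-1.
- by rewrite invr_ge0 ltW//= invf_lt1.
- by rewrite invr_gt0.
rewrite exprVn ltf_pV2 ?posrE ?exprn_gt0// => yx; exists n.
by rewrite (le_lt_trans _ yx)// (le_trans (ler_norm y))// lerDl.
Qed.

Lemma powR_exponent_le r s x : 0 < x ->
  (forall t, 0 < t < 1 -> t `^ r <= x * t `^ s) -> s <= r.
Proof.
move=> x0 H; rewrite leNgt; apply/negP => rs.
have sr : 0 < s - r by rewrite subr_gt0.
pose M := x + 1; have M1 : 1 < M by rewrite ltrDr.
have M0 : 0 < M := lt_trans ltr01 M1.
(* Chosen so that [t] to the power [s - r] is [M^-1]; the assumed bound at this [t] then reads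
   [x + 1 <= x]. *)
pose t := M `^ (- (s - r)^-1).
have t0 : 0 < t by rewrite powR_gt0.
have t1 : t < 1.
  rewrite /t /powR gt_eqF// -expR0 ltr_expR nmulr_rlt0 ?ln_gt0//.
  by rewrite oppr_lt0 invr_gt0.
have := H t; rewrite t0 t1 => /(_ isT).
have -> : s = r + (s - r) by rewrite addrC subrK.
rewrite powRD; last by rewrite (gt_eqF t0) implybT.
rewrite mulrCA ler_pMr ?powR_gt0//.
rewrite -powRrM mulNr mulVf ?gt_eqF// powR_inv1 ?(ltW M0)//.
by rewrite ler_pdivlMr// mul1r; apply/negP; rewrite -ltNge ltrDl.
Qed.

End real_powers.

(** * Growth of psi and uniqueness of its scaling exponent *)

Section scaling.
Context {R : realType} (a b alpha : R) (psi : R -> R).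
Hypothesis a1 : 1 < a.
Hypothesis b01 : 0 < b < 1.
Hypothesis alpha0 : 0 < alpha.
Hypothesis ab : a * b `^ alpha = 1.
Hypothesis psi0 : psi 0 = 0.
Hypothesis psi_scale : forall s, 0 <= s -> psi s = a * psi (b * s).
Hypothesis psi_le : forall s t, 0 <= s -> s <= t -> psi s <= psi t.
Hypothesis psi1 : 0 < psi 1.

Let a0 : 0 < a := lt_trans ltr01 a1.
Let b0 : 0 < b. Proof. by case/andP: b01. Qed.
Let b1 : b < 1. Proof. by case/andP: b01. Qed.

Lemma psi_expand (n : nat) (s : R) : 0 <= s ->
  psi (s / b ^+ n) = a ^+ n * psi s.
Proof.
elim: n => [|n IH] s0; first by rewrite !expr0 divr1 mul1r.
rewrite psi_scale ?divr_ge0 ?exprn_ge0 ?(ltW b0)//.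
rewrite (_ : b * _ = s / b ^+ n); first by rewrite IH// exprS mulrA.
by rewrite exprS; field; rewrite expf_neq0 gt_eqF.
Qed.

Lemma psi_gt0 (s : R) : 0 < s -> 0 < psi s.
Proof.
move=> s0; have [n bn] := exists_exprn_lt b s ltac:(by rewrite ltW) s0.
have := psi_le 1 (s / b ^+ n) ler01.
rewrite ler_pdivlMr ?exprn_gt0// mul1r (ltW bn) psi_expand ?(ltW s0)//.
by move=> /(_ isT) /(lt_le_trans psi1); rewrite pmulr_rgt0// exprn_gt0.
Qed.

(* [s `^ alpha] also scales by [1/a] when [s] is multiplied by [b], so it is
   enough to compare it with [psi] on [[b, 1]]. *)
Lemma psi_powR_bounds (s : R) : 0 < s <= 1 ->
  s `^ alpha * psi 1 / a <= psi s <= a * s `^ alpha * psi 1.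
Proof.
move=> /andP[s0 s1].
have [n bn] := exists_exprn_lt b s ltac:(by rewrite ltW) s0.
elim: n s s0 s1 bn => [|n IH] s s0 s1 bn.
  by move: bn; rewrite expr0 ltNge s1.
have [bs|sb] := leP b s.
  have sa1 : s `^ alpha <= 1.
    by rewrite -(powRr0 s) ger_powR ?s0 ?(ltW alpha0).
  have sab : 1 <= a * s `^ alpha.
    by rewrite -ab ler_pM2l// ge0_ler_powR ?nnegrE ?(ltW alpha0)
      ?(ltW b0) ?(ltW s0).
  apply/andP; split.
    have -> : psi s = psi s * a / a by rewrite mulfK ?gt_eqF.
    rewrite ler_pM2r ?invr_gt0// (le_trans (y := psi 1))//.
      by rewrite ger_pMl.
    rewrite (psi_scale 1)// mulr1 mulrC ler_pM2r//.
    by rewrite psi_le// ltW.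
  apply: (le_trans (y := psi 1)); first by rewrite psi_le// ltW.
  by rewrite ler_peMl ?(ltW psi1).
have := IH (s / b); rewrite divr_gt0// ler_pdivrMr// mul1r (ltW sb).
rewrite ltr_pdivlMr// -exprSr bn => /(_ isT isT isT).
have -> : psi (s / b) = a * psi s.
  by have := psi_expand 1 s (ltW s0); rewrite !expr1.
rewrite powRM ?invr_ge0 ?(ltW b0) ?(ltW s0)//.
have -> : b^-1 `^ alpha = a.
  rewrite -powR_inv1 ?(ltW b0)// -powRrM mulN1r powRN.
  have ba0 : b `^ alpha != 0 by rewrite gt_eqF// powR_gt0.
  by apply: (mulIf ba0); rewrite mulVf// ab.
move=> /andP[L U]; apply/andP; split.
  by rewrite -(ler_pM2l a0) (le_trans _ L)// le_eqVlt; apply/orP; left;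
     apply/eqP; ring.
by rewrite -(ler_pM2l a0) (le_trans U)// le_eqVlt; apply/orP; left;
   apply/eqP; ring.
Qed.

(** Iterating the relation from 1 gives [psi 1 = a' ^+ n * psi (c ^+ n)]. Comparing [psi] with the
    power [alpha] at [c ^+ n] keeps all powers of [r] between [a^-1] and [a], which forces
    [r = 1]. *)
Lemma scale_exponent (a' c : R) : 0 < c < 1 -> 0 < a' ->
  (forall s, 0 <= s -> psi s = a' * psi (c * s)) -> a' * c `^ alpha = 1.
Proof.
move=> /andP[c0 c1] a'0 Hc.
pose r := a' * c `^ alpha.
have E n : psi 1 = a' ^+ n * psi (c ^+ n).
  elim: n => [|n IH]; first by rewrite !expr0 mul1r.
  rewrite IH exprSr -mulrA; congr (_ * _).
  by rewrite [LHS]Hc ?exprn_ge0 ?ltW// exprS.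
have B n : r ^+ n <= a /\ a^-1 <= r ^+ n.
  have cn : 0 < c ^+ n <= 1 by rewrite exprn_gt0//= exprn_ile1// ltW.
  have /andP[] := psi_powR_bounds _ cn.
  have -> : (c ^+ n) `^ alpha = (c `^ alpha) ^+ n.
    by rewrite -powR_mulrn ?ltW// powRAC powR_mulrn ?powR_ge0.
  have an0 : 0 < a' ^+ n by rewrite exprn_gt0.
  rewrite -(ler_pM2l an0) -E => L; rewrite -(ler_pM2l an0) -E => U.
  rewrite /r exprMn; split.
    rewrite -(mul1r a) -ler_pdivrMr// -(ler_pM2r psi1) mul1r (le_trans _ L)//.
    by rewrite le_eqVlt; apply/orP; left; apply/eqP; ring.
  rewrite -div1r ler_pdivrMr// -(ler_pM2r psi1) mul1r (le_trans U)//.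
  by rewrite le_eqVlt; apply/orP; left; apply/eqP; ring.
have r0 : 0 < r by rewrite mulr_gt0 ?powR_gt0.
apply/eqP; rewrite -/r eq_le !leNgt; apply/andP; split; apply/negP => r1.
  have [n] := exists_exprn_gt r a r1.
  by rewrite ltNge (B n).1.
have [||n] := exists_exprn_lt r a^-1; rewrite ?r1 ?ltW ?invr_gt0//.
by rewrite ltNge (B n).2.
Qed.

End scaling.

(** * Identification of the Harris law from its generating function *)

Section harris_identification.
Context {R : realType} {d} {T : measurableType d} (P : probability T R).
Variable N : {mfun T >-> nat}.
Hypothesis N0 : forall w, (0 < N w)%N.

Lemma pmass_sum_gap (m : nat) (t : R) :
  (forall n, (2 <= n < m.+2)%N -> pmass P N n = 0) ->
  \sum_(n < m.+2) pmass P N n * t ^+ n = pmass P N 1 * t.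
Proof.
move=> p0; rewrite big_ord_recl big_ord_recl /= big1 ?addr0; last first.
  by move=> n _; rewrite p0 ?mul0r// /bump/= !ltnS ltn_ord.
by rewrite pmass_0// mul0r add0r expr1.
Qed.

Lemma pgf_first_order (t : R) : 0 <= t <= 1 ->
  pmass P N 1 * t <= pgf P N t <= pmass P N 1 * t + t ^+ 2.
Proof.
move=> t01; have := pgf_partial_sum P N 2 t t01.
by rewrite pmass_sum_gap//; case=> [|[|]].
Qed.

(* The coefficient of [t] in the generating function is read off along
   [t = (1 + u a^n)^(-beta)], which tends to [0]. *)
Lemma pgf_homogeneous (a beta u v : R) : 1 < a -> 0 < beta -> 0 < u -> 0 < v ->
  (forall n, pgf P N ((1 + a ^+ n * u) `^ (- beta)) =
             (1 + a ^+ n * v) `^ (- beta)) ->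
  v `^ (- beta) = pmass P N 1 * u `^ (- beta).
Proof.
move=> a1 beta0 u0 v0 H; have a0 : 0 < a := lt_trans ltr01 a1.
set p := pmass P N 1.
pose x n : R := (a^-1) ^+ n.
have x0 n : 0 < x n by rewrite exprn_gt0 ?invr_gt0.
have x_cvg : x n @[n --> \oo] --> (0 : R).
  by apply: cvg_expr; rewrite ger0_norm ?invr_ge0 ?(ltW a0)// invf_lt1.
have split_power n w : 0 < w ->
    (1 + a ^+ n * w) `^ (- beta) = x n `^ beta * (x n + w) `^ (- beta).
  move=> w0; have -> : 1 + a ^+ n * w = (x n)^-1 * (x n + w).
    by rewrite mulrDr mulVf ?gt_eqF// /x exprVn invrK.
  rewrite powRM ?invr_ge0 ?(ltW (x0 n)) ?addr_ge0 ?(ltW (x0 n)) ?(ltW w0)//.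
  by rewrite -(powR_inv1 (ltW (x0 n))) -powRrM mulN1r opprK.
have cvg_power w : 0 < w ->
    (x n + w) `^ (- beta) @[n --> \oo] --> w `^ (- beta).
  move=> w0; have cw : x n + w @[n --> \oo] --> w.
    by rewrite -[X in _ --> X]add0r; apply: cvgD => //; exact: cvg_cst.
  have -> : (fun n => (x n + w) `^ (- beta)) =
      (fun n => expR (- beta * ln (x n + w))).
    by apply/funext => n; rewrite /powR gt_eqF// addr_gt0.
  rewrite /powR gt_eqF//.
  apply: continuous_cvg; first exact: continuous_expR.
  apply: cvgM; first exact: cvg_cst.
  by apply: continuous_cvg => //; exact: continuous_ln.
(* This is [pgf_first_order] divided by [x n]^ beta[. The quadratic remainder keeps one such factor,
   equal to](a [^ (- beta)) ^+ n], and so tends to 0. *)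
have squeeze n : p * (x n + u) `^ (- beta) <= (x n + v) `^ (- beta) <=
    p * (x n + u) `^ (- beta) +
    (a `^ (- beta)) ^+ n * ((x n + u) `^ (- beta) * (x n + u) `^ (- beta)).
  have xb0 : 0 < x n `^ beta by rewrite powR_gt0.
  have base1 : 1 <= 1 + a ^+ n * u.
    by rewrite lerDl mulr_ge0 ?exprn_ge0 ?(ltW a0) ?(ltW u0).
  have t01 : 0 <= (1 + a ^+ n * u) `^ (- beta) <= 1.
    rewrite powR_ge0/= -[leRHS](powRr0 (1 + a ^+ n * u)).
    by rewrite ler_powR// oppr_le0 ltW.
  have := pgf_first_order _ t01; rewrite H !split_power// -/p.
  rewrite [p * _]mulrCA ler_pM2l// => /andP[-> U] /=.
  have -> : (a `^ (- beta)) ^+ n = x n `^ beta.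
    rewrite -powR_mulrn ?powR_ge0// powRAC powR_mulrn ?(ltW a0)//.
    by rewrite /x exprVn -(powR_inv1 (exprn_ge0 _ (ltW a0))) -powRrM mulN1r.
  rewrite -(ler_pM2l xb0) (le_trans U)//.
  by rewrite le_eqVlt; apply/orP; left; apply/eqP; ring.
have lhs_cvg : p * (x n + u) `^ (- beta) @[n --> \oo] --> p * u `^ (- beta).
  by apply: cvgM; [exact: cvg_cst|exact: cvg_power].
apply: (cvg_unique _ (cvg_power _ v0)) => //.
apply: (squeeze_cvgr _ lhs_cvg); first by near=> n; exact: squeeze.
rewrite -[X in _ --> X]addr0; apply: cvgD => //.
rewrite -(mul0r (u `^ (- beta) * u `^ (- beta))).
apply: cvgM; last by apply: cvgM; exact: cvg_power.
apply: cvg_expr; rewrite ger0_norm ?powR_ge0// powRN invf_lt1 ?powR_gt0//.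
by rewrite /powR gt_eqF// -expR0 ltr_expR mulr_gt0// ln_gt0.
Unshelve. all: by end_near. Qed.

Lemma powRN_linear_bounds (a beta z : R) : 1 < a -> 0 < beta -> 0 < z < 1 ->
  a `^ (- beta) * (beta * (a - 1) / a) * z <=
  (a - (a - 1) * z) `^ (- beta) - a `^ (- beta) <= beta * (a - 1) * z.
Proof.
move=> a1 beta0 /andP[z0 z1]; have a0 : 0 < a := lt_trans ltr01 a1.
set w := a - (a - 1) * z.
have w1 : 1 <= w.
  have -> : w = 1 + (a - 1) * (1 - z) by rewrite /w; ring.
  by rewrite lerDl mulr_ge0 ?subr_ge0 ?ltW.
have w0 : 0 < w := lt_le_trans ltr01 w1.
have wa : w < a by rewrite ltrBlDr ltrDl mulr_gt0// subr_gt0.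
have E y : 0 < y -> y `^ (- beta) = expR (- beta * ln y).
  by move=> y0; rewrite /powR gt_eqF.
have tangent (x y : R) : expR x * (y - x) <= expR y - expR x.
  have -> : expR y = expR x * expR (y - x) by rewrite -expRD addrC subrK.
  rewrite -[X in _ <= _ - X]mulr1 -mulrBr ler_pM2l ?expR_gt0// lerBrDl.
  exact: expR_ge1Dx.
have ln_bound (x y : R) : 0 < x -> 0 < y -> ln x - ln y <= x / y - 1.
  move=> x0 y0; rewrite -ln_div ?posrE//.
  have := @le_ln1Dx R (x / y - 1); rewrite [1 + _]addrC subrK; apply.
  by rewrite ltrBrDr addNr divr_gt0.
rewrite !E//; apply/andP; split.
  apply: le_trans (tangent _ _); rewrite -mulrA ler_pM2l ?expR_gt0//.
  have -> : - beta * ln w - - beta * ln a = beta * - (ln w - ln a) by ring.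
  rewrite -!mulrA ler_pM2l//.
  have -> : (a - 1) * (a^-1 * z) = - (w / a - 1).
    by rewrite /w; field; rewrite gt_eqF.
  by rewrite lerN2 ln_bound.
have := tangent (- beta * ln w) (- beta * ln a).
rewrite -lerN2 opprB => /le_trans; apply; rewrite -mulrN opprB.
have -> : - beta * ln w - - beta * ln a = beta * (ln a - ln w) by ring.
have lnaw : 0 <= ln a - ln w by rewrite subr_ge0 ler_ln ?posrE ?(ltW wa).
have Ew : expR (- beta * ln w) <= 1.
  by rewrite -expR0 ler_expR mulNr oppr_le0 mulr_ge0 ?ln_ge0 ?(ltW beta0).
apply: (le_trans (y := beta * (ln a - ln w))).
  by rewrite ler_piMl ?mulr_ge0 ?(ltW beta0).
rewrite -mulrA ler_pM2l// (le_trans (ln_bound _ _ a0 w0))//.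
have -> : (a - 1) * z = a - w by rewrite /w; ring.
rewrite -[X in _ - X](@divff _ w) ?gt_eqF// -mulrBl ler_pdivrMr//.
by rewrite ler_peMr// subr_ge0 ltW.
Qed.

Lemma harris_of_pgf (a beta : R) : 1 < a -> 0 < beta ->
  pmass P N 1 = a `^ (- beta) ->
  (forall u, 0 < u ->
     pgf P N ((1 + u) `^ (- beta)) = (1 + a * u) `^ (- beta)) ->
  exists k : nat, [/\ (0 < k)%N, harris P N a k & beta = k%:R^-1].
Proof.
move=> a1 beta0 p1 H; have a0 : 0 < a := lt_trans ltr01 a1.
set g := beta^-1; have g0 : 0 < g by rewrite invr_gt0.
(* Each such [t] is [(1 + u)]^ (- beta)[for the positive number]u = (t [^ g)^-1 - 1]. *)
have pgfE t : 0 < t < 1 ->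
    pgf P N t = t * (a - (a - 1) * t `^ g) `^ (- beta).
  move=> /andP[t0 t1].
  have z0 : 0 < t `^ g by rewrite powR_gt0.
  have z1 : t `^ g < 1.
    by rewrite /powR gt_eqF// -expR0 ltr_expR pmulr_rlt0// ln_lt0// t0.
  have zE : t = ((t `^ g)^-1) `^ (- beta) by rewrite -powRN powRVN.
  have := H ((t `^ g)^-1 - 1); rewrite subr_gt0 invf_gt1// => /(_ z1).
  rewrite [1 + _]addrC subrK -zE => ->.
  have w0 : 0 < a - (a - 1) * t `^ g.
    have -> : a - (a - 1) * t `^ g = 1 + (a - 1) * (1 - t `^ g) by ring.
    by rewrite addr_gt0// mulr_gt0// subr_gt0.
  set w := a - _ in w0 *.
  have -> : t * w `^ (- beta) = ((t `^ g)^-1) `^ (- beta) * w `^ (- beta).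
    by rewrite -zE.
  rewrite -powRM ?invr_ge0 ?(ltW z0) ?(ltW w0)//.
  by congr (_ `^ _); rewrite /w; field; rewrite gt_eqF.
pose c1 := a `^ (- beta) * (beta * (a - 1) / a).
pose c2 := beta * (a - 1).
have a10 : 0 < a - 1 by rewrite subr_gt0.
have c10 : 0 < c1 by rewrite !mulr_gt0 ?powR_gt0 ?invr_gt0.
have c20 : 0 < c2 by rewrite mulr_gt0.
have excess t : 0 < t < 1 ->
    t * (c1 * t `^ g) <= pgf P N t - pmass P N 1 * t <= t * (c2 * t `^ g).
  move=> t01; rewrite pgfE// p1; move: (t01) => /andP[t0 t1].
  rewrite [_ * t]mulrC -mulrBr !ler_pM2l//.
  apply: powRN_linear_bounds => //; rewrite powR_gt0//=.
  by rewrite /powR gt_eqF// -expR0 ltr_expR pmulr_rlt0// ln_lt0// t0.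
have gap_le m : (forall n, (2 <= n < m.+2)%N -> pmass P N n = 0) ->
    m.+1%:R <= g.
  move=> p0; apply: (@powR_exponent_le _ _ _ c1^-1); rewrite ?invr_gt0// => t.
  move=> t01; have /andP[t0 t1] := t01.
  have /andP[L _] := excess t t01.
  have /andP[_] := pgf_partial_sum P N m.+2 t ltac:(by rewrite !ltW).
  rewrite pmass_sum_gap// addrC -lerBlDr => U.
  have := le_trans L U; rewrite exprS ler_pM2l// powR_mulrn ?(ltW t0)//.
  by rewrite ler_pdivlMl.
(* Without such an index, [gap_le] would bound every positive integer by [g]; the integer just above
   [g] gives the contradiction. *)
have supp : exists m, (2 <= m)%N && (pmass P N m != 0).
  apply: contrapT => none.
  have := gap_le (Num.truncn g).
  have gap n : (2 <= n < (Num.truncn g).+2)%N -> pmass P N n = 0.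
    move=> /andP[n2 _]; apply: contrapT => /eqP pn; apply: none.
    by exists n; rewrite n2.
  by move=> /(_ gap); rewrite leNgt truncnS_gt.
(* The least index is written [k.+2]. The excess has the extra factor [t], so the Harris parameter
   is [k.+1]. *)
case: (ex_minnP supp) => -[|[|k]]// /andP[_ pk] kmin.
have kg : k.+1%:R <= g.
  apply: gap_le => n /andP[n2 nk]; apply: contrapT => /eqP pn.
  by have := kmin n; rewrite n2 pn => /(_ isT); rewrite leqNgt nk.
have gk : g <= k.+1%:R.
  have pk0 : 0 < pmass P N k.+2 by rewrite lt_neqAle eq_sym pk pmass_ge0.
  apply: (@powR_exponent_le _ _ _ (c2 / pmass P N k.+2)).
    by rewrite divr_gt0.
  move=> t t01; have /andP[t0 t1] := t01.
  have /andP[_ U] := excess t t01.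
  have /andP[L _] := pgf_partial_sum P N k.+3 t ltac:(by rewrite !ltW).
  move: L; rewrite big_ord_recr/= pmass_sum_gap; last first.
    move=> n /andP[n2 nk]; apply: contrapT => /eqP pn.
    by have := kmin n; rewrite n2 pn => /(_ isT); rewrite leqNgt nk.
  rewrite addrC -lerBrDr => /le_trans/(_ U).
  rewrite exprS mulrCA ler_pM2l// powR_mulrn ?(ltW t0)// => LU.
  by rewrite mulrAC ler_pdivlMr// mulrC.
have gE : g = k.+1%:R by apply/eqP; rewrite eq_le gk kg.
have betaE : beta = k.+1%:R^-1 by rewrite -gE invrK.
exists k.+1; split => //; split => // t /andP[t0 t1].
(* [pgfE] covers only the open interval, so the endpoints are treated directly; the value at 0 uses
   that [N] is positive. *)
move: t0; rewrite le_eqVlt => /predU1P[<-|t0]; first by rewrite pgf_0// mul0r.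
move: t1; rewrite le_eqVlt => /predU1P[->|t1].
  by rewrite pgf_1 expr1n mulr1 subKr powR1 divr1.
by rewrite pgfE ?t0// gE powR_mulrn ?(ltW t0)// powRN betaE.
Qed.

End harris_identification.

(** * Stability of a semi Mittag-Leffler law forces Harris *)

Section semi_mittag_leffler.
Context {R : realType} (mu : probability (measurableTypeR R) R).
Context (a b alpha beta : R) (psi : R -> R).
Hypothesis mu_law : law_on_nonneg mu.
Hypothesis mu_nondeg : Defs.nondegenerate mu.
Hypothesis beta0 : 0 < beta.
Hypothesis b01 : 0 < b < 1.
Hypothesis a1 : 1 < a.
Hypothesis alpha0 : 0 < alpha.
Hypothesis ab : a * b `^ alpha = 1.
Hypothesis psi_cont : {within `[0, +oo[, continuous psi}.
Hypothesis psi0 : psi 0 = 0.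
Hypothesis psi_scale : forall s, 0 <= s -> psi s = a * psi (b * s).
Hypothesis psi_pos : forall s, 0 <= s -> 0 < 1 + psi s.
Hypothesis laplaceE :
  forall s, 0 <= s -> laplace mu s = (1 + psi s) `^ (- beta).

Lemma psi_nondecreasing (s t : R) : 0 <= s -> s <= t -> psi s <= psi t.
Proof.
move=> s0 st; have t0 := le_trans s0 st.
have := laplace_nonincreasing mu _ _ s0 st.
by rewrite !laplaceE// ler_powRN ?psi_pos// lerD2l.
Qed.

Lemma psi_1_gt0 : 0 < psi 1.
Proof.
rewrite lt_neqAle eq_sym -{2}psi0 psi_nondecreasing// andbT.
apply/eqP => psi10; apply: (laplace_1_neq1 _ mu_law mu_nondeg).
by rewrite laplaceE// psi10 addr0 powR1.
Qed.

Let psi_gt0 := psi_gt0 a b psi a1 b01 psi_scale psi_nondecreasing psi_1_gt0.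
Let psi_expand := psi_expand a b psi b01 psi_scale.

Lemma psi_surjective (u : R) : 0 < u -> exists2 s, 0 < s & psi s = u.
Proof.
move=> u0; have [b0 _] := andP b01.
have [n un] := exists_exprn_gt a (u / psi 1) a1.
pose M := 1 / b ^+ n.
have M0 : 0 <= M by rewrite divr_ge0// exprn_ge0// ltW.
have psiM : u <= psi M.
  by rewrite /M psi_expand// -ler_pdivrMr ?psi_1_gt0// ltW.
have [||s] := @IVT R psi 0 M u M0.
- apply: continuous_subspaceW psi_cont => x /=.
  by rewrite !in_itv/= andbT => /andP[].
- by rewrite psi0 ge_min le_max psiM (ltW u0) orbT.
rewrite in_itv/= => /andP[s0 _] psis; exists s => //.
rewrite lt_neqAle s0 andbT; apply: contraTneq u0 => s_eq0.
by rewrite -psis -s_eq0 psi0 ltxx.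
Qed.

Context {d} {T : measurableType d} (P : probability T R).
Variable N : {mfun T >-> nat}.
Hypothesis N0 : forall w, (0 < N w)%N.

Lemma sum_stable_harris (c : R) : sum_stable P N c mu ->
  exists (k : nat) (a' : R),
    [/\ (0 < k)%N, harris P N a' k & beta = k%:R^-1] /\
    [/\ 1 < a', a' * c `^ alpha = 1 &
        forall s, 0 <= s -> psi s = a' * psi (c * s)].
Proof.
move=> [_ /andP[c0 c1] stable].
have [b0 _] := andP b01.
have stable_psi s : 0 < s ->
    pgf P N ((1 + psi (c * s)) `^ (- beta)) = (1 + psi s) `^ (- beta).
  by move=> s0; rewrite -!laplaceE ?mulr_ge0 ?(ltW c0) ?(ltW s0)// stable.
(* Stability is applied at [s / b ^+ n] for all [n]: by [psi_expand] both values of [psi] are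
   multiplied by [a ^+ n], as [pgf_homogeneous] requires. *)
have hom s : 0 < s ->
    psi s `^ (- beta) = pmass P N 1 * psi (c * s) `^ (- beta).
  move=> s0; have cs0 : 0 < c * s by rewrite mulr_gt0.
  apply: (pgf_homogeneous P N N0 a) => //; rewrite ?psi_gt0// => n.
  rewrite -!psi_expand ?(ltW s0) ?(ltW cs0)// -mulrA stable_psi//.
  by rewrite divr_gt0// exprn_gt0.
have p0 : 0 < pmass P N 1.
  have := hom 1 ltr01; rewrite mulr1 => h1.
  have : 0 < psi 1 `^ (- beta) by rewrite powR_gt0// psi_gt0.
  by rewrite h1 pmulr_lgt0// powR_gt0// psi_gt0.
(* Raising [hom] to the power [- beta^-1] makes it linear in [psi], with this factor. *)
pose a' := pmass P N 1 `^ (- beta^-1).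
have a'0 : 0 < a' by rewrite powR_gt0.
have psi_a' s : 0 <= s -> psi s = a' * psi (c * s).
  rewrite le_eqVlt => /predU1P[<-|s0]; first by rewrite mulr0 psi0 mulr0.
  have cs0 : 0 < psi (c * s) by rewrite psi_gt0// mulr_gt0.
  apply: (powRN_inj beta) => //; [exact: psi_gt0|exact: mulr_gt0|].
  by rewrite hom// powRM ?(ltW a'0) ?(ltW cs0)// powRVN.
have a'c : a' * c `^ alpha = 1.
  apply: (scale_exponent a b alpha psi) => //; last by rewrite c0.
  - exact: psi_nondecreasing.
  - exact: psi_1_gt0.
have a'1 : 1 < a'.
  rewrite -a'c gtr_pMr// /powR gt_eqF// -expR0 ltr_expR.
  by rewrite pmulr_rlt0// ln_lt0// c0.
have [||k [k0 hk bk]] := harris_of_pgf P N N0 a' beta a'1 beta0.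
- by rewrite powRVN.
(* With [u = psi s], stability at [s / c] is the required identity, because
   [psi (s / c) = a' * u]. *)
- move=> u u0; have [s s0 psis] := psi_surjective u u0.
  have sc0 : 0 < s / c by rewrite divr_gt0.
  have := stable_psi _ sc0; rewrite (psi_a' _ (ltW sc0)).
  by rewrite mulrC divfK ?gt_eqF// psis.
- by exists k, a'.
Qed.

End semi_mittag_leffler.

Lemma harris_sum_stable {R : realType} (mu : probability (measurableTypeR R) R)
    {d} {T : measurableType d} (P : probability T R) (N : {mfun T >-> nat})
    (a b : R) (k : nat) :
  (0 < k)%N -> SML a b k%:R^-1 mu -> harris P N a k -> sum_stable P N b mu.
Proof.
move=> k0 [[law _ _ /andP[b0 b1] a1] [_ [psi [_ psi0 psi_scale psi_pos LE]]]].
move=> [_ _ PE]; split; rewrite ?b0// => s s0.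
have bs0 : 0 < b * s by rewrite mulr_gt0.
rewrite !LE ?(ltW s0) ?(ltW bs0)//.
have kR : 0 < k%:R^-1 :> R by rewrite invr_gt0 ltr0n.
have u0 : 0 < 1 + psi (b * s) by rewrite psi_pos// ltW.
have au0 := psi_pos _ (ltW s0).
(* This puts the argument of the generating function in [[0, 1]], where the Harris formula is
   available. *)
have psi_ge0 : 0 <= psi (b * s).
  rewrite -{1}psi0.
  exact: (psi_nondecreasing mu k%:R^-1 psi kR psi_pos LE _ _ _ (ltW bs0)).
set u := 1 + psi (b * s) in u0 *.
rewrite PE; last first.
  rewrite powR_ge0/= -[leRHS](powRr0 u) ler_powR ?oppr_le0 ?(ltW kR)//.
  by rewrite lerDl.
rewrite -(powR_mulrn _ (powR_ge0 _ _)) -powRrM mulNr mulVf ?pnatr_eq0 -?lt0n//.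
rewrite powR_inv1 ?(ltW u0)// !powRN -invfM; congr (_^-1).
have w0 : 0 <= a - (a - 1) * u^-1.
  have -> : a - (a - 1) * u^-1 = (1 + psi s) / u.
    by rewrite (psi_scale s (ltW s0)) /u; field; rewrite gt_eqF.
  by rewrite divr_ge0 ?(ltW u0) ?(ltW au0).
rewrite -powRM ?(ltW u0)//; congr (_ `^ _).
by rewrite (psi_scale s (ltW s0)) /u; field; rewrite gt_eqF.
Qed.

(* The pair (a, b) representing a given law is not unique: SML(a, b, beta) is
   also SML(a ^+ n, b ^+ n, beta).  With the scale parameter equal to b, the
   law of N is Harris with the given a; with an arbitrary scale parameter c,
   the law is SML(a', c, 1/k) and N is Harris(a', k), with the same a' and k
   in both. *)
Theorem theorem4p1 (R : realType) (a b beta : R)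
  (mu : probability (measurableTypeR R) R)
  (d : measure_display) (T : measurableType d) (P : probability T R)
  (N : {mfun T >-> nat}) :
  0 < beta ->
  SML a b beta mu ->
  (forall w, (0 < N w)%N) ->
  (forall c : R, sum_stable P N c mu <->
     exists (k : nat) (a' b' : R),
       [/\ (0 < k)%N, SML a' b' k%:R^-1 mu, harris P N a' k,
           beta = k%:R^-1 & c = b']) /\
  (sum_stable P N b mu <->
     exists k : nat, [/\ (0 < k)%N, harris P N a k & beta = k%:R^-1]).
Proof.
move=> beta0 sml N0.
have [[law nondeg _ b01 a1] [[al /andP[al0 al1] ab] [psi
  [psi_cont psi0 psi_scale psi_pos LE]]]] := sml.
have stable_harris := sum_stable_harris mu a b al beta psi law nondeg beta0 b01
  a1 al0 ab psi_cont psi0 psi_scale psi_pos LE P N N0.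
split=> [c|]; split.
- move=> st; have [k [a' [[k0 hk bk] [a'1 ac psi_c]]]] := stable_harris c st.
  (* The same [psi] represents the law with [(a', c)] in place of [(a, b)], and with the same
     [alpha]. *)
  have [_ c01 _] := st; exists k, a', c; split => //; split.
    by split => //; rewrite -bk.
  split; first by exists al => //; rewrite al0.
  by exists psi; split => // s s0; rewrite LE// bk.
- by move=> [k [a' [b' [k0 sml' hk _ ->]]]]; exact: harris_sum_stable hk.
- move=> st; have [k [a' [[k0 hk bk] [_ ac _]]]] := stable_harris b st.
  have bal0 : b `^ al != 0 by rewrite gt_eqF// powR_gt0//; case/andP: b01.
  have aE : a' = a by apply: (mulIf bal0); rewrite ac ab.
  by exists k; split => //; rewrite -aE.
- move=> [k [k0 hk bk]]; apply: harris_sum_stable hk => //.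
  by rewrite -bk.
Qed.
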